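(* Let $D$ be an integral domain of characteristic zero with field of fractions $Q(D)$, and let $A,B,w\in A_1(D)$ with $[A,B]\in D^*$ and $[A,w]=0$. Then $w\in Q(D)[A]$ (viewed inside $A_1(Q(D))\supseteq A_1(D)$).
   Context: For a commutative ring $R$, the first Weyl algebra $A_1(R)$ is the unital associative $R$-algebra generated by $X,Y$ subject to $[Y,X]=YX-XY=1$; it is a free $R$-module with basis $\{X^iY^j\}_{i,j\ge0}$, and $A_1(D)\subseteq A_1(Q(D))$. $[P,Q]=PQ-QP$. $D^*$ is the group of units of $D$. $Q(D)[A]$ denotes the $Q(D)$-subalgebra of $A_1(Q(D))$ generated by $A$. *)

(* Defs.v *)
From HB Require Import structures.
From mathcomp Require Import all_boot all_order all_algebra.
Set Implicit Arguments. Unset Strict Implicit. Unset Printing Implicit Defensive.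
Import Order.TTheory GRing.Theory Num.Theory.
Local Open Scope ring_scope.

(* The first Weyl algebra A_1(R) over a commutative ring R, as the free
   R-module with basis X^i Y^j (i,j >= 0).  An element
   w = \sum_{i,j} w_{ij} X^i Y^j is encoded by p : {poly {poly R}} with
   p`_i`_j = w_{ij}  (outer index = power of X, inner index = power of Y).
   The carrier {poly {poly R}} is only used as a finitely supported
   coefficient table; its own (commutative) multiplication is NOT used. *)
Definition weyl (R : comNzRingType) := {poly {poly R}}.

Definition wmono (R : comNzRingType) (i j : nat) : weyl R :=
  (('X^j : {poly R})%:P) * 'X^i.

(* Multiplication of A_1(R), determined by [Y,X] = YX - XY = 1:
   (X^a Y^b)(X^c Y^d) = \sum_k k! C(b,k) C(c,k) X^(a+c-k) Y^(b+d-k). *)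
Definition wmul (R : comNzRingType) (p q : weyl R) : weyl R :=
  \sum_(a < size p) \sum_(b < size p`_a)
   \sum_(c < size q) \sum_(d < size q`_c)
   \sum_(k < (minn b c).+1)
     ((p`_a`_b * q`_c`_d * (k`! * 'C(b, k) * 'C(c, k))%:R)%:P)
       *: wmono R (a + c - k) (b + d - k).

Definition wone (R : comNzRingType) : weyl R := wmono R 0 0.

Fixpoint wpow (R : comNzRingType) (p : weyl R) (n : nat) : weyl R :=
  match n with
  | 0 => wone R
  | n.+1 => wmul p (wpow p n)
  end.

Definition wcomm (R : comNzRingType) (p q : weyl R) : weyl R :=
  wmul p q - wmul q p.

Definition wscal (R : comNzRingType) (r : R) : weyl R := r%:P%:P.

Definition wfrac (D : idomainType) (p : weyl D) : weyl {fraction D} :=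
  map_poly (map_poly (@tofrac D)) p.

Definition weval (F : comNzRingType) (f : {poly F}) (A : weyl F) : weyl F :=
  \sum_(i < size f) (f`_i)%:P *: wpow A i.

Definition in_subalg (F : comNzRingType) (A w : weyl F) : Prop :=
  exists f : {poly F}, w = weval f A.

(* Main.v *)
Require Import Defs.
From HB Require Import structures.
From mathcomp Require Import all_boot all_order all_algebra.
From mathcomp Require Import polyXY ring zify.
Import GRing.Theory.
Local Open Scope ring_scope.

Set Implicit Arguments.
Unset Strict Implicit.
Unset Printing Implicit Defensive.

(** Let [F] be the field of fractions and normalise [B] so that [[A, B] = 1].
    The derivation [delta w = [w, B]] preserves the centralizer [C] of [A] and
    sends [A] to [1].  Let [deg] be the degree in [Y], with leading coefficients
    in [F[X]], and assume [n := deg A > 0].  If [w] in [C] has degree [m], the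
    vanishing of the top coefficient of [[w, A]] says that the leading
    coefficients of [w^n] and [A^m] have zero Wronskian, so
    [w^n = c A^m + w'] with [w'] in [C] and [deg w' < n m].  Applying [delta] and
    comparing degrees shows that if [deg (delta v) <= deg v - n + K + 1] for all
    [v] in [C], then the same holds with [K] in place of [K + 1].  Some [K] works
    because [delta] raises degrees by at most [deg B]; hence
    [deg (delta w) <= deg w - n].  The same equation shows that
    [delta] has kernel [F] on [C].  By induction on the degree,
    [delta w = g(A)], and [w] differs from [f(A)], with [f' = g], by a constant.
    If [n = 0], then [A = a(X)] with [deg a = 1] and [C = F[X]]. *)

(** * Operators in [Y] over [R[X]]: an associative product built from left multiplication by [Y] *)

Section DiffOp.
Variable R : comNzRingType.
Implicit Types (f g : {poly R}) (p q r : {poly {poly R}}).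

(* The partial derivative in [X], for the outer variable [Y]. *)
Definition coefd q : {poly {poly R}} := map_poly (@deriv R) q.

(* Left multiplication by [Y]: [Y f = f Y + f'] for [f] in [R[X]]. *)
Definition opY q := 'X * q + coefd q.

Lemma coefd_is_zmod_morphism : zmod_morphism coefd.
Proof. exact: raddfB. Qed.

HB.instance Definition _ := GRing.isZmodMorphism.Build
  {poly {poly R}} {poly {poly R}} coefd coefd_is_zmod_morphism.

Lemma opY_is_zmod_morphism : zmod_morphism opY.
Proof. by move=> p q; rewrite /opY raddfB mulrBr opprD addrACA. Qed.

HB.instance Definition _ := GRing.isZmodMorphism.Build
  {poly {poly R}} {poly {poly R}} opY opY_is_zmod_morphism.

Lemma coef_coefd q i : (coefd q)`_i = (q`_i)^`().
Proof. exact: coef_map. Qed.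

Lemma size_coefd q : (size (coefd q) <= size q)%N.
Proof. exact: size_poly. Qed.

Lemma coefdZ f q : coefd (f *: q) = f *: coefd q + f^`() *: q.
Proof.
by apply/polyP => i; rewrite coefD !coefZ !coef_coefd coefZ derivM addrC.
Qed.

Lemma coefdXM q : coefd ('X * q) = 'X * coefd q.
Proof.
apply/polyP => i; rewrite coef_coefd !coefXM coef_coefd.
by case: eqP => // _; rewrite deriv0.
Qed.

Lemma opYZ f q : opY (f *: q) = f *: opY q + f^`() *: q.
Proof. by rewrite /opY coefdZ -scalerAr scalerDr addrA. Qed.

(** The Weyl product in normal order: [Y] acts on [q] through [opY], and coefficients in [R[X]] act
    by scaling. *)
Definition dmul p q := \sum_(b < size p) p`_b *: iter b opY q.

Lemma dmul_widen n p q : (size p <= n)%N ->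
  dmul p q = \sum_(b < n) p`_b *: iter b opY q.
Proof.
move=> le_pn; rewrite /dmul.
rewrite (big_ord_widen n (fun b => p`_b *: iter b opY q)) //.
rewrite big_mkcond; apply: eq_bigr => i _; case: ltnP => // le_pi.
by rewrite nth_default ?scale0r.
Qed.

Lemma dmulBl p q r : dmul (p - q) r = dmul p r - dmul q r.
Proof.
have le_pq : (size (p - q)%R <= maxn (size p) (size q))%N.
  by rewrite -[in leqRHS](size_polyN q) size_polyD.
rewrite (dmul_widen _ le_pq) (dmul_widen _ (leq_maxl (size p) (size q))).
rewrite (dmul_widen _ (leq_maxr (size p) (size q))) -sumrB.
by apply: eq_bigr => b _; rewrite coefB scalerBl.
Qed.

Lemma iter_opY_is_zmod_morphism b : zmod_morphism (iter b opY).
Proof.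
elim: b => [p q //|b IHb p q]; rewrite !iterS -raddfB; congr opY.
exact: IHb.
Qed.

HB.instance Definition _ b := GRing.isZmodMorphism.Build
  {poly {poly R}} {poly {poly R}} (iter b opY) (iter_opY_is_zmod_morphism b).

Lemma dmulBr p q r : dmul p (q - r) = dmul p q - dmul p r.
Proof.
by rewrite /dmul -sumrB; apply: eq_bigr => b _; rewrite raddfB scalerBr.
Qed.

Lemma dmul0l q : dmul 0 q = 0.
Proof. by rewrite /dmul size_poly0 big_ord0. Qed.

Lemma dmul0r q : dmul q 0 = 0.
Proof. by rewrite -[in LHS](subrr 0) dmulBr subrr. Qed.

Lemma dmulDl p q r : dmul (p + q) r = dmul p r + dmul q r.
Proof. by rewrite -{1}[q]opprK dmulBl -[- q]sub0r dmulBl dmul0l sub0r opprK. Qed.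

Lemma dmulDr p q r : dmul p (q + r) = dmul p q + dmul p r.
Proof. by rewrite -{1}[r]opprK dmulBr -[- r]sub0r dmulBr dmul0r sub0r opprK. Qed.

Lemma dmulZl f p q : dmul (f *: p) q = f *: dmul p q.
Proof.
rewrite (@dmul_widen (size p)); last exact: size_scale_leq.
by rewrite scaler_sumr; apply: eq_bigr => b _; rewrite coefZ scalerA.
Qed.

(** Associativity with [Y] as left factor: by [opYZ], [Y] times [f Y^b q] is
    [f Y^(b+1) q + f' Y^b q], which matches the two summands of [opY p]. Iteration and linearity
    over [R[X]] then give [dmulA]. *)
Lemma dmul_opY p q : dmul (opY p) q = opY (dmul p q).
Proof.
rewrite {1}/opY dmulDl (dmul_widen _ (size_coefd p)).
rewrite (@dmul_widen (size p).+1); last first.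
  by apply: leq_trans (size_polyMleq _ _) _; rewrite size_polyX.
rewrite big_ord_recl coefXM scale0r add0r -big_split /= /dmul raddf_sum /=.
by apply: eq_bigr => b _; rewrite opYZ coefXM coef_coefd /=.
Qed.

Lemma dmulA : associative dmul.
Proof.
move=> p q r; rewrite [LHS]/dmul [dmul p q]/dmul.
have iterL b : dmul (iter b opY q) r = iter b opY (dmul q r).
  by elim: b => //= b IHb; rewrite dmul_opY IHb.
elim: (size p) => [|n IHn]; first by rewrite !big_ord0 dmul0l.
by rewrite !big_ord_recr /= dmulDl IHn dmulZl iterL.
Qed.

Lemma dmulCl f q : dmul f%:P q = f *: q.
Proof.
by rewrite (@dmul_widen 1) ?size_polyC_leq1 // big_ord1 coefC.
Qed.

Lemma dmul1l : left_id 1 dmul.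
Proof. by move=> q; rewrite -[1]/(1%:P) dmulCl scale1r. Qed.

Lemma iter_opY1 b : iter b opY 1 = 'X^b.
Proof.
elim: b => [|b IHb] /=; first by rewrite expr0.
rewrite IHb exprS /opY; apply/polyP => i; rewrite coefD coef_coefd coefXn.
by case: eqP => _; rewrite ?raddf0 ?derivC addr0.
Qed.

Lemma dmul1r : right_id 1 dmul.
Proof.
move=> p; rewrite /dmul; under eq_bigr do rewrite iter_opY1.
by rewrite -poly_def coefK.
Qed.

Lemma coef_iter_coefd k q i : (iter k coefd q)`_i = (q`_i)^`(k).
Proof.
by elim: k => // k IHk; rewrite iterS coef_coefd IHk derivnS.
Qed.

(** Multiplication by ['X] and [coefd] commute, so the powers of their sum obey the binomial
    formula. *)
Lemma iter_opYE b q :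
  iter b opY q = \sum_(k < b.+1) ('X^(b - k) * iter k coefd q) *+ 'C(b, k).
Proof.
elim: b => [|b IHb] /=; first by rewrite big_ord1 subnn expr0 mul1r bin0.
rewrite {}IHb /opY mulr_sumr raddf_sum /=.
rewrite [RHS]big_ord_recl /= big_ord_recl /= -addrA; congr (_ + _).
  by rewrite mulrnAr mulrA -exprS !bin0 !subn0.
under [in RHS]eq_bigr => k _ do rewrite /bump /= !add1n binS mulrnDr subSS.
rewrite big_split /=; congr (_ + _).
  rewrite [RHS]big_ord_recr /= bin_small // mulr0n addr0.
  apply: eq_bigr => k _; rewrite /bump /= add1n mulrnAr mulrA -exprS.
  by rewrite -subSn ?subSS.
apply: eq_bigr => k _; rewrite raddfMn /=; congr (_ *+ _).
elim: (b - k)%N => [|n IHn]; first by rewrite expr0 !mul1r.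
by rewrite exprS -mulrA coefdXM IHn mulrA.
Qed.

(** The Leibniz formula, with divided derivatives in [Y]. Its [k]-th term has degree at most
    [deg p + deg q - k], which is the source of all degree estimates. *)
Lemma dmulE n p q : (size p <= n)%N ->
  dmul p q = \sum_(k < n) p^`N(k) * iter k coefd q.
Proof.
move=> le_pn; rewrite (dmul_widen _ le_pn).
transitivity (\sum_(b < n) \sum_(k < n)
   p`_b *: (('X^b)^`N(k) * iter k coefd q)).
  apply: eq_bigr => b _; rewrite -scaler_sumr iter_opYE; congr (_ *: _).
  rewrite (big_ord_widen n
    (fun k => ('X^(b - k) * iter k coefd q) *+ 'C(b, k))) //.
  rewrite big_mkcond; apply: eq_bigr => k _; rewrite nderivnXn mulrnAl ltnS.
  by case: leqP => // lt_bk; rewrite bin_small.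
rewrite exchange_big; apply: eq_bigr => k _ /=.
under eq_bigr do rewrite scalerAl -nderivnZ.
rewrite -mulr_suml -raddf_sum -poly_def; congr (nderivn _ _ * _).
apply/polyP => i; rewrite coef_poly; case: ltnP => // le_ni.
by rewrite nth_default // (leq_trans le_pn).
Qed.

End DiffOp.

(* [\sum_b p`_b Y^b], with coefficients [p`_b] in [R[X]] on the left; unlike in
   [weyl], the outer variable is [Y]. *)
Definition dop (R : comNzRingType) := {poly {poly R}}.

Section DiffOpRing.
Variable R : comNzRingType.

HB.instance Definition _ := GRing.Zmodule.on (dop R).
Lemma dop_oner_neq0 : (1%:P : dop R) != 0.
Proof. exact: oner_neq0. Qed.
HB.instance Definition _ := GRing.Zmodule_isNzRing.Build (dop R)
  (@dmulA R) (@dmul1l R) (@dmul1r R) (@dmulDl R)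
  (@dmulDr R) dop_oner_neq0.

End DiffOpRing.

(** * Degrees in [Y] and top coefficients of products and commutators *)

Section TopCoefficients.

Lemma coefM_top (S : nzRingType) (p q : {poly S}) m n :
  (size p <= m.+1)%N -> (size q <= n.+1)%N -> (p * q)`_(m + n) = p`_m * q`_n.
Proof.
move=> sp sq; rewrite coefM.
have lt_m : (m < (m + n).+1)%N by lia.
rewrite (bigD1 (Ordinal lt_m)) //= addKn big1 ?addr0 // => i.
rewrite -val_eqE /= => ne_im; case: (ltnP m i) => [lt_mi|le_im].
  by rewrite (nth_default _ (leq_trans sp lt_mi)) mul0r.
have lt_im : (i < m)%N by rewrite ltn_neqAle ne_im.
by rewrite [q`__]nth_default ?mulr0 // (leq_trans sq) //; lia.
Qed.

Lemma coef_derivM_top (S : nzRingType) (p q : {poly S}) m n s :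
  (size p <= m.+1)%N -> (size q <= n.+1)%N -> (m + n)%N = s.+1 ->
  (p^`() * q)`_s = (p`_m * q`_n) *+ m.
Proof.
case: m => [|m] sp sq eq_mn.
  by rewrite (size1_polyC sp) derivC mul0r coef0.
have -> : s = (m + n)%N by lia.
rewrite coefM_top ?coef_deriv ?mulrnAl //.
by apply: leq_trans (size_poly _ _) _; lia.
Qed.

End TopCoefficients.

Section DiffOpDegree.
Variable R : comNzRingType.
Implicit Types p q : {poly {poly R}}.

(** The terms of [dmulE] with [k >= 2] have degree at most [m + n - 2], so the two top degrees only
    see the commutative product and the first-order term. *)
Lemma dmul_approx p q m n : (size p <= m.+1)%N -> (size q <= n.+1)%N ->
  (size (dmul p q - (p * q + p^`() * coefd q))%R <= (m + n).-1)%N.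
Proof.
move=> sp sq; rewrite (dmulE _ (leqW sp)).
rewrite big_ord_recl big_ord_recl /= nderivn0 nderivn1 addrA.
rewrite (addrC _ (\sum_(i < m) _)) addrK.
apply: leq_trans (size_sum _ _ _) _; apply/bigmax_leqP => k _.
apply: leq_trans (size_polyMleq _ _) _.
have sN : (size (p^`N(bump 0 (bump 0 k)))%R <= m.+1 - k.+2)%N.
  by apply: leq_trans (size_poly _ _) _; rewrite /bump; lia.
have sD i : (size (iter i (@coefd R) q) <= n.+1)%N.
  by elim: i => //= i; apply: leq_trans (size_coefd _).
move: (ltn_ord k) (sD k.+2) sN; rewrite /= add0n.
move: (size (coefd _)) => a; move: (size _) => b; move: (nat_of_ord k) => l.
by lia.
Qed.

Lemma dmul_size p q m n : (size p <= m.+1)%N -> (size q <= n.+1)%N ->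
  (size (dmul p q) <= (m + n).+1)%N.
Proof.
move=> sp sq; rewrite -[dmul p q](subrK (p * q + p^`() * coefd q)).
apply: leq_trans (size_polyD _ _) _; rewrite geq_max; apply/andP; split.
  by apply: leq_trans (dmul_approx sp sq) _; lia.
apply: leq_trans (size_polyD _ _) _; rewrite geq_max; apply/andP; split.
  by apply: leq_trans (size_polyMleq _ _) _; lia.
apply: leq_trans (size_polyMleq _ _) _.
have := size_coefd q; have : (size p^`() <= m)%N.
  by apply: leq_trans (size_poly _ _) _; lia.
by lia.
Qed.

Lemma dmul_coef_top p q m n : (size p <= m.+1)%N -> (size q <= n.+1)%N ->
  (dmul p q)`_(m + n) = p`_m * q`_n.
Proof.
move=> sp sq; rewrite -[dmul p q](subrK (p * q + p^`() * coefd q)).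
rewrite coefD [X in X + _]nth_default ?add0r; last first.
  by apply: leq_trans (dmul_approx sp sq) _; lia.
rewrite coefD coefM_top // [X in _ + X]nth_default ?addr0 //.
apply: leq_trans (size_polyMleq _ _) _.
have := size_coefd q; have : (size p^`() <= m)%N.
  by apply: leq_trans (size_poly _ _) _; lia.
by lia.
Qed.

(** The commutative products cancel, leaving the Poisson bracket of [p] and [q]; the errors
    controlled by [dmul_approx] have degree below [s]. *)
Lemma dmul_comm_coef p q m n s :
  (size p <= m.+1)%N -> (size q <= n.+1)%N -> (m + n)%N = s.+1 ->
  (dmul p q - dmul q p)`_s =
    (p`_m * (q`_n)^`()) *+ m - (q`_n * (p`_m)^`()) *+ n.
Proof.
move=> sp sq es.
have ->: dmul p q - dmul q p =
    (dmul p q - (p * q + p^`() * coefd q))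
    - (dmul q p - (q * p + q^`() * coefd p))
    + (p^`() * coefd q - q^`() * coefd p).
  move: (dmul _ _) (dmul _ _) => x y; rewrite (mulrC q p); ring.
rewrite coefD [X in X + _]nth_default ?add0r; last first.
  apply: leq_trans (size_polyD _ _) _; rewrite geq_max size_polyN.
  apply/andP; split.
    by apply: leq_trans (dmul_approx sp sq) _; rewrite es.
  by apply: leq_trans (dmul_approx sq sp) _; rewrite addnC es.
rewrite coefB (coef_derivM_top sp (leq_trans (size_coefd _) sq) es).
rewrite addnC in es.
by rewrite (coef_derivM_top sq (leq_trans (size_coefd _) sp) es) !coef_coefd.
Qed.

End DiffOpDegree.

(** * Vanishing Wronskians in characteristic zero *)

Section Char0.
Variable S : idomainType.
Hypothesis charS : [pchar S] =i pred0.

Lemma pchar0_mulrn_eq0 (x : S) n : (x *+ n == 0) = (n == 0)%N || (x == 0).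
Proof. by rewrite -mulr_natr mulf_eq0 orbC; have /pcharf0P-> := charS. Qed.

Lemma pchar0_mulrnI (x : S) m n : x != 0 -> x *+ m = x *+ n -> m = n.
Proof.
move=> x0; wlog le_mn : m n / (m <= n)%N => [hw|].
  by case: (leqP m n) => [/hw//|/ltnW/hw h /esym/h].
move/eqP; rewrite eq_sym -subr_eq0 -mulrnBr // pchar0_mulrn_eq0 (negPf x0) orbF.
by rewrite subn_eq0 => le_nm; apply/eqP; rewrite eqn_leq le_mn.
Qed.

Lemma pchar0_poly : [pchar {poly S}] =i pred0.
Proof. by move=> n; rewrite pchar_poly charS. Qed.

Lemma deriv_eq0 (p : {poly S}) : p^`() = 0 -> (size p <= 1)%N.
Proof.
move=> dp; apply/leq_sizeP => -[//|i] _.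
have /eqP := congr1 (fun q : {poly S} => q`_i) dp.
by rewrite coef_deriv coef0 pchar0_mulrn_eq0 => /eqP.
Qed.

(** The top coefficient of [p' q - p q'] is [deg p - deg q] times both leading coefficients. *)
Lemma size_wronskian0 (p q : {poly S}) :
  p != 0 -> q != 0 -> p^`() * q = p * q^`() -> size p = size q.
Proof.
move=> p0 q0 eq_pq; have sp := polySpred p0; have sq := polySpred q0.
move: (leqnn (size p)) (leqnn (size q)); rewrite {2}sp {2}sq => lp lq.
case es: ((size p).-1 + (size q).-1)%N => [|s]; first by lia.
have es' : ((size q).-1 + (size p).-1)%N = s.+1 by rewrite addnC.
have := congr1 (fun r : {poly S} => r`_s) eq_pq.
rewrite (mulrC p) (coef_derivM_top lp lq es) (coef_derivM_top lq lp es').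
rewrite (mulrC q`__) => /pchar0_mulrnI eq_s; rewrite sp sq eq_s //.
by rewrite mulf_neq0 ?lead_coef_eq0.
Qed.

End Char0.

(** With [c] the quotient of leading coefficients, [p - c q] again has zero Wronskian with [q]. Were
    it nonzero, it would have the degree of [q], where its coefficient has just been cancelled. *)
Lemma wronskian0_proportional (F : fieldType) (charF : [pchar F] =i pred0)
    (p q : {poly F}) :
  p != 0 -> q != 0 -> p^`() * q = p * q^`() ->
  exists2 c : F, c != 0 & p = c *: q.
Proof.
move=> p0 q0 eq_pq; have s_pq := size_wronskian0 charF p0 q0 eq_pq.
pose c := lead_coef p / lead_coef q.
have c0 : c != 0 by rewrite mulf_neq0 ?invr_eq0 ?lead_coef_eq0.
exists c => //; apply/eqP; rewrite -subr_eq0; apply: contraT => r0.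
have /(size_wronskian0 charF r0 q0) :
    (p - c *: q)^`() * q = (p - c *: q) * q^`().
  by rewrite derivB derivZ !mulrBl eq_pq -!scalerAl (mulrC q).
move=> e; have := negPf r0; rewrite -lead_coef_eq0 lead_coefE e coefB coefZ.
by rewrite -[X in p`_X.-1]s_pq -!lead_coefE divfK ?subrr ?eqxx ?lead_coef_eq0.
Qed.

(** * Central scalars, leading terms over a domain, and the inner derivation *)

Section Scalars.
Variable R : comNzRingType.

Definition dcst (c : R) : dop R := c%:P%:P.

Lemma dcst_is_zmod_morphism : zmod_morphism dcst.
Proof. by move=> c d; rewrite /dcst !polyCB. Qed.

Lemma dcst_is_monoid_morphism : monoid_morphism dcst.
Proof.
split=> // c d; rewrite -[RHS]/(dmul _ _) dmulCl /dcst.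
by rewrite -mul_polyC -!polyCM.
Qed.

HB.instance Definition _ :=
  GRing.isZmodMorphism.Build R (dop R) dcst dcst_is_zmod_morphism.
HB.instance Definition _ :=
  GRing.isMonoidMorphism.Build R (dop R) dcst dcst_is_monoid_morphism.

Lemma dcstM c (p : dop R) : dcst c * p = c%:P *: (p : {poly {poly R}}).
Proof. exact: dmulCl. Qed.

Lemma dcst_comm c (p : dop R) : GRing.comm (dcst c) p.
Proof.
rewrite /GRing.comm dcstM -[RHS]/(dmul _ _) /dmul.
have -> : dcst c = c%:P *: (1 : {poly {poly R}}) by rewrite alg_polyC.
rewrite -[p in LHS]dmul1r /dmul scaler_sumr; apply: eq_bigr => b _.
rewrite scalerA mulrC -scalerA; congr (_ *: _).
by elim: (nat_of_ord b) => //= k <-; rewrite opYZ derivC scale0r addr0.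
Qed.

End Scalars.

Section Domain.
Variable R : idomainType.
Implicit Types p q : dop R.

Let le_size p : (size p <= (size p).-1.+1)%N.
Proof. by case: (size p). Qed.

Lemma dop_lead p q : p != 0 -> q != 0 ->
  size (p * q) = ((size p).-1 + (size q).-1).+1
  /\ lead_coef (p * q) = lead_coef p * lead_coef q.
Proof.
move=> p0 q0; have top := dmul_coef_top (le_size p) (le_size q).
have s_pq : size (dmul p q) = ((size p).-1 + (size q).-1).+1.
  apply/eqP; rewrite eqn_leq (dmul_size (le_size p) (le_size q)) /= ltnNge.
  apply/negP => /leq_sizeP/(_ _ (leqnn _)); rewrite top => /eqP.
  by rewrite mulf_eq0 -!lead_coefE !lead_coef_eq0 (negPf p0) (negPf q0).
by split=> //; rewrite !lead_coefE -top -[p * q]/(dmul p q) s_pq.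
Qed.

Lemma dop_mul_neq0 p q : p != 0 -> q != 0 -> p * q != 0.
Proof. by move=> p0 q0; rewrite -size_poly_eq0 (dop_lead p0 q0).1. Qed.

Lemma dop_exp_neq0 p k : p != 0 -> p ^+ k != 0.
Proof.
move=> p0; elim: k => [|k IHk]; first exact: oner_neq0.
by rewrite exprS dop_mul_neq0.
Qed.

Lemma dop_lead_exp p k : p != 0 ->
  size (p ^+ k) = (k * (size p).-1).+1 /\ lead_coef (p ^+ k) = lead_coef p ^+ k.
Proof.
move=> p0; elim: k => [|k [IHs IHl]].
  rewrite !expr0 -[1]/(1%:P : {poly {poly R}}).
  by rewrite size_polyC oner_neq0 lead_coefC.
rewrite !exprS; have [-> ->] := dop_lead p0 (dop_exp_neq0 k p0).
by rewrite IHs IHl mulSn.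
Qed.

(** The derivation [delta]; the bracket is taken in this order so that [[A, B] = 1] sends [A] to
    [1]. *)
Definition ad (B w : dop R) : dop R := w * B - B * w.

Lemma adM B v w : ad B (v * w) = ad B v * w + v * ad B w.
Proof. by rewrite /ad mulrBl mulrBr !mulrA [RHS]addrC addrA subrK. Qed.

Lemma adB B v w : ad B (v - w) = ad B v - ad B w.
Proof. by rewrite /ad mulrBl mulrBr opprD addrACA -opprD. Qed.

Lemma ad_dcst B c : ad B (dcst c) = 0.
Proof. by rewrite /ad (dcst_comm c B) subrr. Qed.

(** Deriving [w A = A w] adds [w] on both sides, and it cancels. *)
Lemma ad_comm A B w : ad B A = 1 -> GRing.comm w A -> GRing.comm (ad B w) A.
Proof.
move=> hAB wA; apply/eqP; rewrite -subr_eq0; apply/eqP.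
have := congr1 (ad B) wA; rewrite !adM hAB mulr1 mul1r addrC => /addrI ->.
by rewrite subrr.
Qed.

(** Leading coefficients commute even though [w] and [ad B w] need not, so at the top degree the
    derivative of a power is computed as in a commutative ring. *)
Lemma ad_exp_top B w k e : w != 0 -> (size (ad B w) <= e.+1)%N ->
  (size (ad B (w ^+ k.+1)) <= (k * (size w).-1 + e).+1)%N
  /\ (ad B (w ^+ k.+1) : {poly {poly R}})`_(k * (size w).-1 + e) =
     (lead_coef w ^+ k * (ad B w : {poly {poly R}})`_e) *+ k.+1.
Proof.
move=> w0 se; set m := (size w).-1.
elim: k => [|k [IHs IHc]]; first by rewrite expr1 mul0n add0n expr0 mul1r.
have [sw lw] := dop_lead_exp k.+1 w0.
have sw' : (size (w ^+ k.+1) <= (k.+1 * m).+1)%N by rewrite sw.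
rewrite exprS adM; split.
  apply: leq_trans (size_polyD _ _) _; rewrite geq_max; apply/andP; split.
    by apply: leq_trans (dmul_size se sw') _; rewrite addnC.
  by apply: leq_trans (dmul_size (le_size w) IHs) _; rewrite -/m mulSn addnA.
rewrite coefD; have := dmul_coef_top se sw'; rewrite (addnC e) => ->.
have := dmul_coef_top (le_size w) IHs; rewrite -/m addnA -mulSn => ->.
have -> : (w ^+ k.+1 : {poly {poly R}})`_(k.+1 * m) = lead_coef w ^+ k.+1.
  by rewrite -lw lead_coefE sw.
rewrite IHc -lead_coefE mulrC mulrnAr mulrA -exprS.
by rewrite [in RHS]mulrS.
Qed.

End Domain.

(** * The centralizer of [A]: degree drop and kernel of the derivation *)

Section Centralizer.
Variable F : fieldType.
Hypothesis charF : [pchar F] =i pred0.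
Implicit Types (A B w : dop F).

Let le_size w : (size w <= (size w).-1.+1)%N.
Proof. by case: (size w). Qed.

Let charFX : [pchar {poly F}] =i pred0 := pchar0_poly charF.

Lemma comm_lead_coef A w : GRing.comm w A ->
  lead_coef w * (lead_coef A)^`() *+ (size w).-1 =
  lead_coef A * (lead_coef w)^`() *+ (size A).-1.
Proof.
move=> wA; case es: ((size w).-1 + (size A).-1)%N => [|s].
  by move/eqP: es; rewrite addn_eq0 => /andP[/eqP-> /eqP->].
have := dmul_comm_coef (le_size w) (le_size A) es.
rewrite -[dmul w A]/(w * A) -[dmul A w]/(A * w) wA subrr coef0 -!lead_coefE.
by move/esym/eqP; rewrite subr_eq0 => /eqP.
Qed.

Lemma mul_deriv_exp (p : {poly F}) k : p * (p ^+ k)^`() = p ^+ k * p^`() *+ k.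
Proof.
case: k => [|k]; rewrite ?expr0 ?derivC ?mulr0 // deriv_exp /=.
by rewrite mulrnAr mulrCA -exprS mulrC.
Qed.

Lemma comm_lead_proportional A w : (1 < size A)%N -> w != 0 -> GRing.comm w A ->
  exists2 c : F, c != 0 &
    lead_coef w ^+ (size A).-1 = c *: lead_coef A ^+ (size w).-1.
Proof.
move=> sA w0 wA.
have A0 : A != 0 by rewrite -size_poly_gt0 ltnW.
have f0 : lead_coef w != 0 by rewrite lead_coef_eq0.
have a0 : lead_coef A != 0 by rewrite lead_coef_eq0.
apply: (wronskian0_proportional charF); rewrite ?expf_neq0 //.
have eq_fa := comm_lead_coef wA.
set f := lead_coef w in f0 eq_fa *; set a := lead_coef A in a0 eq_fa *.
set m := (size w).-1 in eq_fa *; set n := (size A).-1 in eq_fa *.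
(* The factors [a] and [f] allow [mul_deriv_exp] to be used without the exponents [n - 1] and
   [m - 1]; the claim then reduces to [eq_fa]. *)
apply: (mulfI a0); apply: (mulfI f0).
transitivity (f ^+ n * a ^+ m * (a * f^`() *+ n)).
  rewrite -mulrnAr.
  transitivity (a * a ^+ m * (f * (f ^+ n)^`())); first by ring.
  by rewrite mul_deriv_exp !mulrnAr; congr (_ *+ _); ring.
rewrite -eq_fa; transitivity (f * f ^+ n * (a * (a ^+ m)^`())); last by ring.
by rewrite mul_deriv_exp !mulrnAr; congr (_ *+ _); ring.
Qed.

(** Both powers have degree [n m], and [c] cancels their leading coefficients; the size bound means
    degree strictly below [n m]. *)
Lemma comm_reduce A w : (1 < size A)%N -> w != 0 -> GRing.comm w A ->
  exists2 c : F, c != 0 &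
    (size (w ^+ (size A).-1 - dcst c * A ^+ (size w).-1)%R
      <= (size A).-1 * (size w).-1)%N.
Proof.
move=> sA w0 wA; have [c c0 eq_c] := comm_lead_proportional sA w0 wA.
have A0 : A != 0 by rewrite -size_poly_gt0 ltnW.
exists c => //; have [sw lw] := dop_lead_exp (size A).-1 w0.
have [sA' lA] := dop_lead_exp (size w).-1 A0.
rewrite dcstM; apply/leq_sizeP => j; rewrite leq_eqVlt coefB coefZ.
case/orP => [/eqP<-|lt_j]; last first.
  by rewrite !nth_default ?mulr0 ?subrr ?sw ?sA' // mulnC.
move: lw lA; rewrite !lead_coefE sw sA' /= => ->; rewrite mulnC => ->.
by rewrite -!lead_coefE eq_c mul_polyC subrr.
Qed.

Section WithDegree.
Variables A B : dop F.
Hypothesis sA : (1 < size A)%N.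
Hypothesis adA : ad B A = 1.
Let n := (size A).-1.

Lemma ad_expA k : ad B (A ^+ k.+1) = A ^+ k *+ k.+1.
Proof.
elim: k => [|k IHk]; first by rewrite expr1 adA expr0.
by rewrite exprS adM adA mul1r IHk mulrnAr -exprS -mulrS.
Qed.

Lemma ad_cexpA c k : ad B (dcst c * A ^+ k) = dcst (c *+ k) * A ^+ k.-1.
Proof.
rewrite adM ad_dcst mul0r add0r; case: k => [|k].
  by rewrite expr0 -(rmorph1 (@dcst F)) ad_dcst mulr0 mulr0n rmorph0 mul0r.
by rewrite ad_expA mulrnAr -mulrnAl -rmorphMn.
Qed.

Let A0 : A != 0.
Proof. by rewrite -size_poly_gt0 ltnW. Qed.

Let n0 : (0 < n)%N.
Proof. by rewrite /n; case: (size A) sA => [|[]]. Qed.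

Lemma size_cexpA c k : c != 0 -> size (dcst c * A ^+ k) = (k * n).+1.
Proof.
by move=> c0; rewrite dcstM size_scale ?polyC_eq0 // (dop_lead_exp k A0).1.
Qed.

Lemma comm_sub_cexp c w k l : GRing.comm w A ->
  GRing.comm (w ^+ k - dcst c * A ^+ l) A.
Proof.
move=> wA; apply/commr_sym/commrB; first exact/commrX/commr_sym.
by apply: commrM; [apply/commr_sym/dcst_comm | apply: commrX].
Qed.

(** Compare degrees in [delta (w^n) = c m A^(m-1) + delta w']. The left side has degree at least
    [(n-1) m + e], with [e] the degree of [delta w]; the strict drop [deg w' < n m] is what lowers
    the slack by one. *)
Lemma ad_degree_step K :
  (forall w, GRing.comm w A -> ad B w != 0 ->
     (size (ad B w) + n <= size w + K.+1)%N) ->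
  forall w, GRing.comm w A -> ad B w != 0 ->
    (size (ad B w) + n <= size w + K)%N.
Proof.
move=> IH w wA dw0.
have w0 : w != 0 by apply: contraNneq dw0 => ->; rewrite /ad mulr0 mul0r subrr.
have [c c0 sw'] := comm_reduce sA w0 wA; rewrite -/n in sw'.
set m := (size w).-1 in sw'; set w' := _ - _ in sw'.
have sd := polySpred dw0; have sw := polySpred w0.
set e := (size (ad B w)).-1 in sd.
have se : (size (ad B w) <= e.+1)%N by rewrite sd.
have [_] := ad_exp_top n.-1 w0 se; rewrite prednK // -/m => top.
have lt_e : (n.-1 * m + e < size (ad B (w ^+ n)))%N.
  rewrite ltnNge; apply/negP => /leq_sizeP/(_ _ (leqnn _))/eqP; rewrite top.
  rewrite (pchar0_mulrn_eq0 charFX) mulf_eq0 expf_eq0 lead_coef_eq0 (negPf w0).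
  by rewrite -lead_coefE lead_coef_eq0 (negPf dw0) andbF !orbF (gtn_eqF n0).
have eq_w : ad B (w ^+ n) = dcst (c *+ m) * A ^+ m.-1 + ad B w'.
  by rewrite /w' adB ad_cexpA addrC subrK.
have := leq_trans lt_e; rewrite eq_w => /(_ _ (size_polyD _ _)).
(* If the power of [A] reaches this degree, then [(n-1) m + e <= n (m-1)], the bound without slack.
   Otherwise [delta w'] does, and [IH] applies to [w']. *)
rewrite leq_max => /orP[lt1|lt2].
  case: (posnP m) => [m0|m0].
    by move: lt1; rewrite m0 mulr0n rmorph0 mul0r size_poly0.
  have cm0 : c *+ m != 0.
    by rewrite (pchar0_mulrn_eq0 charF) negb_or c0 -lt0n m0.
  move: lt1; rewrite size_cexpA // sd sw -/m.
  move: n0 m0; move: (n) (m) => [|k] [|l] //= _ _; rewrite mulnS mulnC; lia.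
have w'0 : ad B w' != 0 by apply: contraTneq lt2 => ->; rewrite size_poly0.
have := IH _ (comm_sub_cexp c n m wA) w'0; rewrite -/w' sd sw -/m.
move: lt2 sw' n0; move: (n) => [|k] //=; rewrite mulSn; lia.
Qed.

Lemma ad_degree w : GRing.comm w A -> ad B w != 0 ->
  (size (ad B w) + n <= size w)%N.
Proof.
rewrite -[leqRHS]addn0; move: w.
(* [K] counts the steps made, so the slack descends from [n + size B], where the crude bound
   [deg w + deg B] suffices, to zero. *)
suff H K : (K <= n + size B)%N -> forall w, GRing.comm w A -> ad B w != 0 ->
    (size (ad B w) + n <= size w + (n + size B - K))%N.
  by rewrite -(subnn (n + size B)); apply: H.
elim: K => [_|K IHK lt_K]; last first.
  by apply: ad_degree_step; rewrite -subSn // subSS; apply: IHK; apply: ltnW.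
move=> w wA dw0; rewrite subn0 addnC addnCA leq_add2l.
have w0 : w != 0 by apply: contraNneq dw0 => ->; rewrite /ad mulr0 mul0r subrr.
have sw := polySpred w0.
apply: leq_trans (size_polyD _ _) _; rewrite size_polyN geq_max.
by apply/andP; split;
  apply: leq_trans (dmul_size (le_size _) (le_size _)) _; lia.
Qed.

(** Here [delta (w^n) = 0], so [c m A^(m-1) = - delta w']. For [m > 0] the left side has degree
    [n (m-1)], while [ad_degree] puts the right side strictly below. Hence [w] lies in [F[X]], and
    [comm_lead_coef] makes its derivative vanish. *)
Lemma ad_kernel w : GRing.comm w A -> ad B w = 0 -> exists c, w = dcst c.
Proof.
move=> wA dw0; have [->|w0] := eqVneq w 0; first by exists 0; rewrite rmorph0.
have m0 : (size w).-1 = 0.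
  have [c c0 sw'] := comm_reduce sA w0 wA; rewrite -/n in sw'.
  set m := (size w).-1 in sw' *; set w' := _ - _ in sw'.
  have dwn : ad B (w ^+ n) = 0.
    have wB : GRing.comm B w by apply/eqP; rewrite eq_sym -subr_eq0; apply/eqP.
    by rewrite /ad (commrX n wB) subrr.
  have eq_w : dcst (c *+ m) * A ^+ m.-1 = - ad B w'.
    by rewrite /w' adB ad_cexpA dwn sub0r opprK.
  apply/eqP; apply: contraT; rewrite -lt0n => m0.
  have cm0 : c *+ m != 0.
    by rewrite (pchar0_mulrn_eq0 charF) negb_or c0 -lt0n m0.
  have := congr1 (fun p : {poly {poly F}} => size p) eq_w.
  rewrite size_cexpA // size_polyN => sdw'.
  have w'0 : ad B w' != 0 by rewrite -size_poly_eq0 -sdw'.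
  have := ad_degree (comm_sub_cexp c n m wA) w'0; rewrite -/w' -sdw'.
  move: sw' m0; move: (m) => [|k] //= sw' _; move: sw'.
  by rewrite mulnS mulnC; lia.
have := comm_lead_coef wA; rewrite m0 mulr0n => /esym/eqP.
rewrite (pchar0_mulrn_eq0 charFX) (gtn_eqF n0) mulf_eq0.
rewrite lead_coef_eq0 (negPf A0).
move=> /eqP/(deriv_eq0 charF) sf; exists (lead_coef w)`_0.
rewrite /dcst -size1_polyC // lead_coefE m0; apply: size1_polyC.
by rewrite (polySpred w0) m0.
Qed.

End WithDegree.

End Centralizer.

(** * Elements commuting with [A] are polynomials in [A] *)

Section CentralizerTheorem.
Variable F : fieldType.
Hypothesis charF : [pchar F] =i pred0.
Implicit Types (A B w : dop F).

Definition deval A (f : {poly F}) : dop F := (map_poly (@dcst F) f).[A].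

Lemma devalMXaddC A f c : deval A (f * 'X + c%:P) = deval A f * A + dcst c.
Proof.
by rewrite /deval rmorphD rmorphM /= map_polyX map_polyC hornerMXaddC.
Qed.

Lemma ad_deval A B f : ad B A = 1 -> ad B (deval A f) = deval A f^`().
Proof.
move=> adA; elim/poly_ind: f => [|f c IHf].
  rewrite deriv0 /deval rmorph0 horner0 -[LHS]/(ad B 0).
  by rewrite /ad mulr0 mul0r subrr.
rewrite devalMXaddC -[dcst c]opprK -rmorphN adB ad_dcst subr0 adM adA IHf mulr1.
have -> : (f * 'X + c%:P)^`() = f^`() * 'X + 0%:P + f.
  by rewrite derivMXaddC addr0 addrC.
have devalD g h : deval A (g + h) = deval A g + deval A h.
  by rewrite /deval rmorphD hornerD.
by rewrite devalD devalMXaddC rmorph0 addr0.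
Qed.

Lemma deval_comm A f : GRing.comm (deval A f) A.
Proof.
elim/poly_ind: f => [|f c IHf].
  by rewrite /deval rmorph0 horner0 /GRing.comm mulr0 mul0r.
rewrite devalMXaddC; apply/commr_sym/commrD.
  by apply: commrM => //; apply/commr_sym.
exact/commr_sym/dcst_comm.
Qed.

Lemma poly_primitive (g : {poly F}) : exists f : {poly F}, f^`() = g.
Proof.
(* At [i = 0] the division by zero yields the constant term [0]. *)
exists (\poly_(i < (size g).+1) (g`_i.-1 / i%:R)).
apply/polyP => i; rewrite coef_deriv coef_poly ltnS /=.
case: ltnP => [_|le_i]; last by rewrite mul0rn nth_default.
by rewrite -[LHS]mulr_natr divfK //; have /pcharf0P-> := charF.
Qed.

Lemma centralizer_degree_gt0 A B w : (1 < size A)%N -> ad B A = 1 ->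
  GRing.comm w A -> exists f, w = deval A f.
Proof.
move=> sA adA; move: {2}(size w) (leqnn (size w)) => N.
elim: N w => [|N IHN] w le_w wA.
  exists 0; rewrite /deval rmorph0 horner0; apply/eqP.
  by rewrite -size_poly_leq0.
have [g eq_g] : exists g, ad B w = deval A g.
  have [->|dw0] := eqVneq (ad B w) 0.
    by exists 0; rewrite /deval rmorph0 horner0.
  apply: IHN; last exact: ad_comm.
  rewrite -ltnS; apply: leq_trans le_w.
  apply: leq_trans (ad_degree charF sA adA wA dw0).
  by rewrite -addn1 leq_add2l -ltnS (ltn_predK sA).
(* With [f' = g], the difference of [w] and [f(A)] commutes with [A] and is killed by [ad B], hence
   is constant. *)
have [f eq_f] := poly_primitive g.
have [||c] := @ad_kernel _ charF A B sA adA (w - deval A f).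
- by apply/commr_sym/commrB; apply/commr_sym => //; apply: deval_comm.
- by rewrite adB (ad_deval _ adA) eq_f eq_g subrr.
move/eqP; rewrite subr_eq => /eqP eq_w; exists (f + c%:P).
by rewrite eq_w /deval rmorphD hornerD /= map_polyC hornerC addrC.
Qed.

Lemma dop_polyCM (f g : {poly F}) :
  (f%:P : dop F) * (g%:P : dop F) = (f * g)%:P.
Proof. by rewrite -[LHS]/(dmul _ _) dmulCl -mul_polyC -polyCM. Qed.

(** Expansion of [g] in base [a]: repeated division by the linear polynomial [a] leaves constant
    remainders. *)
Lemma polyC_deval (a g : {poly F}) : size a = 2 ->
  exists f, (g%:P : dop F) = deval a%:P f.
Proof.
move=> sa; move: {2}(size g) (leqnn (size g)) => N.
have a0 : a != 0 by rewrite -size_poly_gt0 sa.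
elim: N g => [|N IHN] g le_g.
  exists 0; rewrite /deval rmorph0 horner0; apply/eqP.
  by rewrite polyC_eq0 -size_poly_leq0.
have [|f eq_f] := IHN (g %/ a); first by rewrite size_divp // sa leq_subLR.
have sr : (size (g %% a)%R <= 1)%N by have := ltn_modp g a; rewrite a0 sa.
exists (f * 'X + ((g %% a)`_0)%:P); rewrite devalMXaddC -eq_f dop_polyCM /dcst.
by rewrite -(size1_polyC sr) -polyCD -divp_eq.
Qed.

Lemma centralizer_degree0 A B w : (size A <= 1)%N -> ad B A = 1 ->
  GRing.comm w A -> exists f, w = deval A f.
Proof.
move=> sA adA wA; rewrite (size1_polyC sA) in adA wA *.
set a : {poly F} := (A : {poly {poly F}})`_0 in adA wA *.
have da0 : a^`() != 0.
  apply/negP => /eqP/(deriv_eq0 charF) s_a.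
  move/eqP: adA; rewrite (size1_polyC s_a) -[_%:P%:P]/(dcst _) ad_dcst.
  by rewrite eq_sym oner_eq0.
have sa : size a = 2.
  have sB : (size B <= (size B).-1.+1)%N by case: (size B).
  have := @dmul_comm_coef F a%:P B 0 (size B).-1 _ (size_polyC_leq1 _) sB.
  case er: (size B).-1 => [|r].
    rewrite er in sB; move/eqP: adA; rewrite (size1_polyC sB) /ad !dop_polyCM.
    by rewrite mulrC subrr eq_sym oner_eq0.
  move=> /(_ r erefl); rewrite -[_ - _]/(ad B a%:P) adA.
  rewrite mulr0n sub0r [a%:P`_0]coefC /=.
  have b0 : (B : {poly {poly F}})`_r.+1 != 0.
    rewrite -er -lead_coefE lead_coef_eq0.
    by apply: contra_eq_neq er => ->; rewrite size_poly0.
  move/eqP; rewrite -[1]/(1%:P : {poly {poly F}}) [_`_r]coefC -eqr_oppLR.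
  (* The coefficient of [[A, B] = 1] at degree [deg B - 1] is [- deg B] times [b a'], with [b] the
     leading coefficient of [B]. If [deg B > 1] it must vanish, which is impossible; if [deg B = 1]
     then [- b a' = 1], so [a'] is constant. *)
  case: r er b0 => [|r] er b0 /=; last first.
    rewrite oppr0 eq_sym (pchar0_mulrn_eq0 (pchar0_poly charF)) mulf_eq0.
    by rewrite (negPf b0) (negPf da0).
  rewrite mulr1n => /eqP/(congr1 (fun p : {poly F} => size p)).
  rewrite size_polyN size_poly1 size_mul // => sba.
  have := b0; have := da0; rewrite -!size_poly_gt0 => lda lb.
  have sda : size a^`() = 1.
    by move: sba lda lb; move: (size a^`()) (size _) => i j; lia.
  apply/eqP; rewrite eqn_leq; apply/andP; split; last first.
    apply: leq_ltn_trans lda (lt_size_deriv _).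
    by apply: contraNneq da0 => ->; rewrite deriv0.
  apply/leq_sizeP => -[|[|j]] // _; apply/eqP.
  have : a^`()`_j.+1 == 0 by rewrite nth_default ?sda.
  by rewrite coef_deriv (pchar0_mulrn_eq0 charF).
(* As [A] has degree [0] in [Y], [comm_lead_coef] says that [deg w] times [lead_coef w * a'] is
   zero. *)
have sw : (size w <= 1)%N.
  have := comm_lead_coef wA; rewrite size_polyC lead_coefC.
  have -> : (a != 0).-1 = 0%N by case: (a != 0).
  move/eqP; rewrite mulr0n (pchar0_mulrn_eq0 (pchar0_poly charF)) mulf_eq0.
  rewrite (negPf da0) orbF lead_coef_eq0 -size_poly_eq0.
  by case: (size w) => [|[|]].
by rewrite (size1_polyC sw); apply: polyC_deval.
Qed.

Theorem dop_centralizer A B w : ad B A = 1 -> GRing.comm w A ->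
  exists f, w = deval A f.
Proof.
case: (leqP (size A) 1) => ?; first exact: centralizer_degree0.
exact: centralizer_degree_gt0.
Qed.

End CentralizerTheorem.

(** * Transport to the coefficient tables of [weyl] and to the fraction field *)

Section WeylTransport.
Variable R : comNzRingType.
Implicit Types p q : weyl R.

Definition dmono (x : R) i j : {poly {poly R}} := (x *: 'X^i) *: 'X^j.

Lemma iter_coefd_mono k (g : {poly R}) d :
  iter k (@coefd R) (g *: 'X^d) = g^`(k) *: 'X^d.
Proof.
apply/polyP => i; rewrite coef_iter_coefd !coefZ !coefXn.
by case: eqP => _; rewrite ?mulr1 // !mulr0 linear0.
Qed.

(** The [k]-th term of [dmulE] contributes ['C(b, k)] from the divided derivative of [Y^b] and the
    falling factorial [k! 'C(c, k)] from [X^c]; terms with [k > c] vanish. *)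
Lemma dmul_dmono x y a b c d : dmul (dmono x a b) (dmono y c d) =
  \sum_(k < (minn b c).+1)
     dmono (x * y * (k`! * 'C(b, k) * 'C(c, k))%:R) (a + c - k) (b + d - k).
Proof.
rewrite (@dmulE _ b.+1); last first.
  by apply: leq_trans (size_scale_leq _ _) _; rewrite size_polyXn.
have le_bc : ((minn b c).+1 <= b.+1)%N by rewrite ltnS geq_minl.
rewrite (big_ord_widen b.+1 (fun k =>
  dmono (x * y * (k`! * 'C(b, k) * 'C(c, k))%:R) (a + c - k) (b + d - k))) //.
rewrite [RHS]big_mkcond; apply: eq_bigr => -[k /= lt_kb] _.
rewrite iter_coefd_mono nderivnZ nderivnXn derivnZ derivnXn ltnS leq_min.
rewrite -ltnS lt_kb /=; case: leqP => [le_kc|lt_ck]; last first.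
  by rewrite ffact_small // mulr0n scaler0 scale0r mulr0.
rewrite ltnS in lt_kb.
have -> : (a + c - k = a + (c - k))%N by rewrite addnBA.
have -> : (b + d - k = b - k + d)%N by rewrite addnBAC.
rewrite /dmono -bin_ffact !exprD -!mul_polyC.
move: 'C(b, k) 'C(c, k) k`! ('X^(b - k)) ('X^(c - k)) => n1 n2 n3 u v.
ring.
Qed.

Lemma swapXY_wmono (x : R) i j : swapXY (x%:P *: wmono R i j) = dmono x i j.
Proof.
rewrite /wmono /dmono -mul_polyC !rmorphM /= !swapXY_polyC map_polyC map_polyXn.
rewrite [swapXY _]rmorphXn /= swapXY_X -!mul_polyC polyCM rmorphXn /=.
by rewrite mulrA mulrAC.
Qed.

Lemma swapXYE p :
  swapXY p = \sum_(a < size p) \sum_(b < size p`_a) dmono p`_a`_b a b.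
Proof.
rewrite -[p in LHS]coefK poly_def raddf_sum; apply: eq_bigr => a _.
rewrite -[p`_a in LHS]coefK poly_def scaler_suml raddf_sum.
apply: eq_bigr => b _ /=; rewrite -swapXY_wmono /wmono; congr swapXY.
by rewrite mul_polyC scalerA mul_polyC.
Qed.

(** Expanding [dmul] biadditively over monomials reproduces the sums of [wmul] term by term. *)
Lemma swapXY_wmul p q : swapXY (wmul p q) = dmul (swapXY p) (swapXY q).
Proof.
have dmul_suml I (r : seq I) (G : I -> {poly {poly R}}) s :
    dmul (\sum_(i <- r) G i) s = \sum_(i <- r) dmul (G i) s.
  apply: (big_morph (fun x => dmul x s)) => [x y|]; first exact: dmulDl.
  exact: dmul0l.
have dmul_sumr I (r : seq I) (G : I -> {poly {poly R}}) s :
    dmul s (\sum_(i <- r) G i) = \sum_(i <- r) dmul s (G i).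
  apply: (big_morph (dmul s)) => [x y|]; first exact: dmulDr.
  exact: dmul0r.
rewrite [swapXY p]swapXYE [swapXY q]swapXYE dmul_suml /wmul raddf_sum.
apply: eq_bigr => a _.
rewrite dmul_suml raddf_sum; apply: eq_bigr => b _.
rewrite dmul_sumr raddf_sum; apply: eq_bigr => c _.
rewrite dmul_sumr raddf_sum; apply: eq_bigr => d _.
rewrite dmul_dmono raddf_sum; apply: eq_bigr => k _.
exact: swapXY_wmono.
Qed.

Lemma swapXY_wone : swapXY (wone R) = 1.
Proof. by rewrite /wone /wmono !expr0 mulr1 rmorph1. Qed.

Lemma swapXY_wpow p n : swapXY (wpow p n) = ((swapXY p : dop R) ^+ n).
Proof.
elim: n => [|n IHn] /=; first exact: swapXY_wone.
by rewrite swapXY_wmul IHn exprS.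
Qed.

Lemma swapXY_wscal (c : R) : swapXY (wscal c) = dcst c.
Proof. by rewrite /wscal swapXY_polyC map_polyC. Qed.

End WeylTransport.

Lemma swapXY_weval (F : fieldType) (f : {poly F}) (A : weyl F) :
  swapXY (weval f A) = deval (swapXY A) f.
Proof.
rewrite /deval horner_coef size_map_poly /weval raddf_sum.
apply: eq_bigr => i _; rewrite coef_map [RHS]dcstM -swapXY_wpow /=.
by rewrite -mul_polyC rmorphM /= swapXY_polyC map_polyC mul_polyC.
Qed.

(** Injectivity preserves sizes, hence the summation ranges in [wmul]. *)
Lemma map_wmul (R S : comNzRingType) (h : {rmorphism R -> S}) (p q : weyl R) :
  injective h ->
  map_poly (map_poly h) (wmul p q) =
  wmul (map_poly (map_poly h) p) (map_poly (map_poly h) q).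
Proof.
move=> h_inj.
have szf (r : {poly R}) : size (map_poly h r) = size r.
  by rewrite size_map_inj_poly ?rmorph0.
have szw (r : weyl R) : size (map_poly (map_poly h) r) = size r.
  rewrite size_map_inj_poly ?rmorph0 //.
  by apply: map_inj_poly; rewrite ?rmorph0.
rewrite /wmul szw rmorph_sum; apply: eq_bigr => a _.
rewrite [(map_poly (map_poly h) p)`_a]coef_map /= szf rmorph_sum.
apply: eq_bigr => b _; rewrite szw rmorph_sum; apply: eq_bigr => c _.
rewrite [(map_poly (map_poly h) q)`_c]coef_map /= szf rmorph_sum.
apply: eq_bigr => d _; rewrite rmorph_sum; apply: eq_bigr => k _ /=.
rewrite -!mul_polyC rmorphM /= !map_polyC /= !rmorphM /= rmorph_nat !coef_map.
by rewrite /wmono !map_polyC /= !map_polyXn !rmorph_nat /=.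
Qed.

Lemma wfrac_wmul (D : idomainType) (p q : weyl D) :
  wfrac (wmul p q) = wmul (wfrac p) (wfrac q).
Proof. by apply: map_wmul => x y /eqP; rewrite tofrac_eq => /eqP. Qed.

Theorem weyl_centralizer (F : fieldType) (charF : [pchar F] =i pred0)
    (A B w : weyl F) (u : F) :
  u != 0 -> wcomm A B = wscal u -> wcomm A w = 0 -> in_subalg A w.
Proof.
move=> u0 hAB hAw.
pose phi (p : weyl F) : dop F := swapXY p.
have phi_comm p q : phi (wcomm p q) = phi p * phi q - phi q * phi p.
  by rewrite /phi raddfB /= !swapXY_wmul.
have phiAB : phi A * phi B - phi B * phi A = dcst u.
  by rewrite -phi_comm hAB /phi swapXY_wscal.
(* Dividing [B] by the central scalar [u] normalises the bracket to [1]. *)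
have adA : ad (dcst u^-1 * phi B) (phi A) = 1.
  rewrite /ad mulrA -(dcst_comm _ (phi A)) -!mulrA -mulrBr phiAB.
  by rewrite -rmorphM mulVf // rmorph1.
have wA : GRing.comm (phi w) (phi A).
  by apply/esym/eqP; rewrite -subr_eq0 -phi_comm hAw /phi raddf0.
have [f eq_f] := dop_centralizer charF adA wA.
by exists f; apply: (inv_inj swapXYK); rewrite swapXY_weval.
Qed.

Theorem theorem4p3 (D : idomainType) (charD0 : [pchar D] =i pred0)
    (A B w : weyl D)
    (hAB : exists2 u : D, u \is a GRing.unit & wcomm A B = wscal u)
    (hAw : wcomm A w = 0) :
  in_subalg (wfrac A) (wfrac w).
Proof.
have charF : [pchar {fraction D}] =i pred0.
  apply/pcharf0P => n; rewrite -(rmorph_nat (@tofrac D)) tofrac_eq0.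
  by have /pcharf0P-> := charD0.
have wfrac_comm p q : wcomm (wfrac p) (wfrac q) = wfrac (wcomm p q).
  by rewrite /wcomm -!wfrac_wmul [RHS]raddfB.
case: hAB => u uU hAB.
have u0 : tofrac u != 0.
  by rewrite tofrac_eq0; apply: contraTneq uU => ->; rewrite unitr0.
apply: (weyl_centralizer charF (B := wfrac B) u0).
  by rewrite wfrac_comm hAB /wfrac /wscal !map_polyC /= map_polyC.
by rewrite wfrac_comm hAw /wfrac raddf0.
Qed.
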